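(* Assume that only the PPCA model $\mathcal{M}_k$ and the factor analysis model $\mathcal{F}_k$, both with $k$ components for $p$-dimensional observations, are under consideration. Let $\mathbf{X}=(\mathbf{X}_1,\ldots,\mathbf{X}_n)$ be the data. Then the sBICs of the PPCA model and of the factor analysis model are equal to $$\log(L_{PPCA})=\log\big(p_{PPCA}(\mathbf{X}\mid\hat{\mathbf{W}},\hat\sigma^2)\big)-\frac{pk+k(p-k+1)+2}{4}\log(n),$$ $$\log(L_{FA})=\log\big(p_{FA}(\mathbf{X}\mid\hat{\mathbf{W}},\hat{\boldsymbol\psi})\big)-\frac{pk+k(p-k+1)+2p}{4}\log(n).$$ The PPCA model has a higher sBIC than the factor analysis model if and only if $$\log\left(\frac{p_{FA}(\mathbf{X}\mid\hat{\mathbf{W}},\hat{\boldsymbol\psi})}{p_{PPCA}(\mathbf{X}\mid\hat{\mathbf{W}},\hat\sigma^2)}\right)<\frac{p-1}{2}\log(n).$$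
   Context: Models (sets of covariance matrices of centered Gaussians on $\mathbb{R}^p$, $0\le k\le p-1$): $\mathcal{M}_k=\{\mathbf{W}\mathbf{W}^\top+\sigma^2\mathbf{I}_p:\mathbf{W}\in\mathbb{R}^{p\times k},\sigma^2>0\}$ (PPCA) and $\mathcal{F}_k=\{\mathbf{W}\mathbf{W}^\top+\operatorname{diag}(\psi_1,\ldots,\psi_p):\mathbf{W}\in\mathbb{R}^{p\times k},\psi_i>0\}$ (factor analysis). The model $\mathcal{M}_k$ is the submodel of $\mathcal{F}_k$, so in the model order $\mathcal{M}_k\prec\mathcal{F}_k$. $p_{PPCA}(\mathbf{X}\mid\mathbf{W},\sigma^2)$ and $p_{FA}(\mathbf{X}\mid\mathbf{W},\boldsymbol\psi)$ denote the likelihoods of the sample under $\mathcal{N}_p(\mathbf{0},\mathbf{W}\mathbf{W}^\top+\sigma^2\mathbf{I}_p)$ and $\mathcal{N}_p(\mathbf{0},\mathbf{W}\mathbf{W}^\top+\operatorname{diag}(\psi_1,\ldots,\psi_p))$. Hats denote maximum likelihood estimates in the respective model ($\hat{\mathbf{W}}$ is in general different in the two models). Singular BIC (sBIC), with equal prior model probabilities. Given a finite collection of models partially ordered by $\prec$, let $\hat p_i$ be the maximized likelihood of model $i$, and for $j\preceq i$ let $(\lambda_{ij},\mathfrak{m}_{ij})$ be the learning coefficient and multiplicity of model $i$ along its submodel $j$. For a minimal model $i$, $L_i=\hat p_i\,\log(n)^{\mathfrak{m}_{ii}-1}n^{-\lambda_{ii}}$. For other models, recursively, $$L_i=\tfrac12\big(-b_i+\sqrt{b_i^2+4c_i}\big),\quad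 b_i=-\hat p_i\frac{\log(n)^{\mathfrak{m}_{ii}-1}}{n^{\lambda_{ii}}}+\sum_{j\prec i}L_j,\quad c_i=\sum_{j\prec i}\hat p_i\frac{\log(n)^{\mathfrak{m}_{ij}-1}}{n^{\lambda_{ij}}}L_j.$$ The sBIC of model $i$ is $\log(L_i)$. The learning coefficients and multiplicities used for the two models here (index $0$ for PPCA, $1$ for factor analysis) are $$\lambda_{00}=\frac{pk+k(p-k+1)+2}{4},\qquad\lambda_{11}=\lambda_{10}=\frac{pk+k(p-k+1)+2p}{4},\qquad\mathfrak{m}_{00}=\mathfrak{m}_{11}=\mathfrak{m}_{10}=1.$$ $L_{PPCA}=L_0$ and $L_{FA}=L_1$. *)

(* Defs.v *)
From HB Require Import structures.
From mathcomp Require Import all_boot all_order all_algebra.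
From mathcomp Require Import all_classical all_reals all_analysis.

Set Implicit Arguments.
Unset Strict Implicit.
Unset Printing Implicit Defensive.

Import Order.TTheory GRing.Theory Num.Theory.
Import numFieldNormedType.Exports.

Local Open Scope classical_set_scope.
Local Open Scope ring_scope.

Definition gaussian_pdf (R : realType) (p : nat) (S : 'M[R]_p) (x : 'cV[R]_p) : R :=
  expR (- (x^T *m invmx S *m x) ord0 ord0 / 2)
    / Num.sqrt ((2 * pi) ^+ p * \det S).

Definition likelihood (R : realType) (p n : nat) (X : 'I_n -> 'cV[R]_p)
    (S : 'M[R]_p) : R :=
  \prod_(i < n) gaussian_pdf S (X i).

Definition ppca_cov (R : realType) (p k : nat) (W : 'M[R]_(p, k)) (s2 : R) :
    'M[R]_p :=
  W *m W^T + s2%:M.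

Definition fa_cov (R : realType) (p k : nat) (W : 'M[R]_(p, k)) (psi : 'rV[R]_p) :
    'M[R]_p :=
  W *m W^T + diag_mx psi.

Definition ppca_model (R : realType) (p k : nat) : set 'M[R]_p :=
  [set S | exists (W : 'M[R]_(p, k)) (s2 : R), 0 < s2 /\ S = ppca_cov W s2].

Definition fa_model (R : realType) (p k : nat) : set 'M[R]_p :=
  [set S | exists (W : 'M[R]_(p, k)) (psi : 'rV[R]_p),
     (forall i, 0 < psi ord0 i) /\ S = fa_cov W psi].

Definition p_ppca (R : realType) (p k n : nat) (X : 'I_n -> 'cV[R]_p)
    (W : 'M[R]_(p, k)) (s2 : R) : R :=
  likelihood X (ppca_cov W s2).

Definition p_fa (R : realType) (p k n : nat) (X : 'I_n -> 'cV[R]_p)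
    (W : 'M[R]_(p, k)) (psi : 'rV[R]_p) : R :=
  likelihood X (fa_cov W psi).

Definition ppca_mle (R : realType) (p k n : nat) (X : 'I_n -> 'cV[R]_p)
    (W : 'M[R]_(p, k)) (s2 : R) : Prop :=
  0 < s2 /\
  forall (W' : 'M[R]_(p, k)) (s2' : R), 0 < s2' ->
    p_ppca X W' s2' <= p_ppca X W s2.

Definition fa_mle (R : realType) (p k n : nat) (X : 'I_n -> 'cV[R]_p)
    (W : 'M[R]_(p, k)) (psi : 'rV[R]_p) : Prop :=
  (forall i, 0 < psi ord0 i) /\
  forall (W' : 'M[R]_(p, k)) (psi' : 'rV[R]_p), (forall i, 0 < psi' ord0 i) ->
    p_fa X W' psi' <= p_fa X W psi.

Definition max_likelihood (R : realType) (p n : nat) (X : 'I_n -> 'cV[R]_p)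
    (M : set 'M[R]_p) : R :=
  sup [set likelihood X S | S in M].

Definition sbic_term (R : realType) (T : Type) (n : nat) (phat : T -> R)
    (lam : T -> T -> R) (mult : T -> T -> nat) (i j : T) : R :=
  phat i * (ln n%:R ^+ (mult i j).-1 / n%:R `^ lam i j).

Definition sbic_step (R : realType) (d : Order.disp_t) (T : finPOrderType d)
    (n : nat) (phat : T -> R) (lam : T -> T -> R) (mult : T -> T -> nat)
    (L : T -> R) (i : T) : R :=
  let t := sbic_term n phat lam mult i in
  let b := - t i + \sum_(j | (j < i)%O) L j in
  let c := \sum_(j | (j < i)%O) t j * L j in
  if [forall j, ~~ (j < i)%O] then t i
  else 2^-1 * (- b + Num.sqrt (b ^+ 2 + 4 * c)).

(* The recursion along the strict order terminates after at most #|T| steps,  *)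
(* so iterating the step #|T| times solves it from any initial value; see     *)
(* sbic_LE.                                                                   *)
Definition sbic_L (R : realType) (d : Order.disp_t) (T : finPOrderType d)
    (n : nat) (phat : T -> R) (lam : T -> T -> R) (mult : T -> T -> nat) :
    T -> R :=
  iter #|T| (sbic_step n phat lam mult) (fun=> 0).

Lemma sbic_LE (R : realType) (d : Order.disp_t) (T : finPOrderType d)
    (n : nat) (phat : T -> R) (lam : T -> T -> R) (mult : T -> T -> nat) (i : T) :
  sbic_L n phat lam mult i =
  sbic_step n phat lam mult (sbic_L n phat lam mult) i.
Proof.
set F := sbic_step n phat lam mult.
have stepE (L1 L2 : T -> R) x :
    (forall y, (y < x)%O -> L1 y = L2 y) -> F L1 x = F L2 x.
  move=> L12; rewrite /F /sbic_step; case: ifP => // _.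
  rewrite (eq_bigr L2) // [X in _ + 4 * X](eq_bigr
    (fun j => sbic_term n phat lam mult x j * L2 j)) // => y yx.
  by rewrite L12.
have stab m x : (#|[pred y : T | (y <= x)%O]| <= m)%N ->
    iter m F (fun=> 0) x = iter m.+1 F (fun=> 0) x.
  elim: m x => [|m IHm] x xm.
    by move: xm; rewrite leqn0 => /pred0P/(_ x); rewrite inE lexx.
  apply: (stepE (iter m F _) (iter m.+1 F _)) => y yx; apply: IHm.
  rewrite -ltnS; apply: leq_trans xm; apply: proper_card; apply/properP; split.
    by apply/fintype.subsetP => z; rewrite !inE => /le_trans; apply; exact: ltW.
  exists x; first by rewrite inE lexx.
  by rewrite inE; apply/negP => /(lt_le_trans yx); rewrite ltxx.
by rewrite {1}/sbic_L (stab _ _ (max_card _)).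
Qed.

(* The two competing models are indexed by 'I_2 with its usual order: PPCA is *)
(* ord0 and factor analysis is ord_max. The order is put on the indices, not  *)
(* on the sets, since the two sets coincide when k = p - 1.                   *)
Definition ppca_fa (R : realType) (p k : nat) (i : 'I_2) : set 'M[R]_p :=
  if i == ord0 then @ppca_model R p k else @fa_model R p k.

Lemma ppca_fa_homo (R : realType) (p k : nat) (i j : 'I_2) :
  (i <= j)%O -> @ppca_fa R p k i `<=` @ppca_fa R p k j.
Proof.
move=> ij; rewrite /ppca_fa; have [i0|i0] := eqVneq i ord0.
  have [_|_] := eqVneq j ord0; first by [].
  move=> _ [W [s2 [s2_gt0 ->]]]; exists W, (const_mx s2).
  by split=> [l|]; rewrite ?mxE // /fa_cov diag_const_mx.
have [j0|_] := eqVneq j ord0; last by [].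
by move: ij i0; rewrite j0 leEord leqn0 -val_eqE /= => ->.
Qed.

(* Only the pairs (i, j) with j <= i are meaningful (and used by sbic_L).     *)
Definition ppca_fa_lambda (R : realType) (p k : nat) (i j : 'I_2) : R :=
  (p%:R * k%:R + k%:R * (p%:R - k%:R + 1)
     + (if i == ord0 then 2 else 2 * p%:R)) / 4.

Definition ppca_fa_mult (i j : 'I_2) : nat := 1%N.

Definition ppca_fa_L (R : realType) (p k n : nat) (X : 'I_n -> 'cV[R]_p) :
    'I_2 -> R :=
  sbic_L n (fun i => max_likelihood X (ppca_fa k i))
    (ppca_fa_lambda R p k) ppca_fa_mult.

Definition L_ppca (R : realType) (p k n : nat) (X : 'I_n -> 'cV[R]_p) : R :=
  ppca_fa_L k X ord0.

Definition L_fa (R : realType) (p k n : nat) (X : 'I_n -> 'cV[R]_p) : R :=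
  ppca_fa_L k X ord_max.

(* Main.v *)
Require Import Defs.
From HB Require Import structures.
From mathcomp Require Import all_boot all_order all_algebra.
From mathcomp Require Import polyrcf.
From mathcomp Require Import all_classical all_reals all_analysis.
From mathcomp Require Import ring lra.

Set Implicit Arguments.
Unset Strict Implicit.
Unset Printing Implicit Defensive.

Import Order.TTheory GRing.Theory Num.Theory.
Import numFieldNormedType.Exports.

Local Open Scope classical_set_scope.
Local Open Scope ring_scope.

(** A learning coefficient enters the sBIC recursion for model [i] only through
    the terms [t i j] = (maximized likelihood of [i]) * (power of the sample
    size). Factor analysis has the same learning coefficient along the PPCA
    submodel as along itself, so its terms agree, [t i j = t i i =: t]. Writing
    [s] for the sum of the [L j] over the smaller models, one then has
    [b = s - t] and [c = t * s], hence [b ^+ 2 + 4 * c = (s + t) ^+ 2] and the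
    positive root of the quadratic is exactly [t] ([sbic_L_const_term]): the
    singular correction vanishes and both sBICs have the form of an ordinary
    BIC. Their difference is then the logarithm of the likelihood ratio minus
    the difference of the learning coefficients times [ln n].

    Two points link this to the maximum likelihood estimates. The supremum of
    the likelihood over a model is attained at the estimate
    ([max_likelihood_attained]), and the maximized likelihoods are positive, as
    is needed for taking logarithms of products and quotients. Positivity comes
    down to that of the determinant of a covariance matrix, which is positive
    definite ([posdef_det_gt0], [fa_cov_posdef]). *)

(** The real eigenvalues of [- A] are negative, so its characteristic polynomial, being
    monic, has no sign change between [0] and infinity; its value at [0] is
    [\det A]. *)
Lemma posdef_det_gt0 (R : rcfType) (m : nat) (A : 'M[R]_m) :
  (forall v : 'rV[R]_m, v != 0 -> 0 < (v *m A *m v^T) ord0 ord0) ->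
  0 < \det A.
Proof.
move=> A_pos; set q := char_poly (- A).
have q0E : q.[0] = \det A.
  rewrite horner_coef0 char_poly_det -[- A]scaleN1r detZ mulrA -exprD addnn.
  by rewrite -signr_odd odd_double mul1r.
have q_noroot x : 0 <= x -> ~~ root q x.
  move=> x_ge0; rewrite -eigenvalue_root_char.
  apply/negP => /eigenvalueP[v vE v_neq0].
  have := A_pos v v_neq0.
  have -> : v *m A = - (x *: v) by rewrite -vE mulmxN opprK.
  rewrite mulNmx -scalemxAl !mxE oppr_gt0 ltNge mulr_ge0 // sumr_ge0 // => i _.
  by rewrite mxE -expr2 sqr_ge0.
have lc_gt0 : 0 < lead_coef q by rewrite (monicP (char_poly_monic _)).
have [M qM] := poly_pinfty_gt_lc lc_gt0.
pose N := Num.max 0 M.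
have N_ge0 : 0 <= N by rewrite le_max lexx.
have qN_gt0 : 0 < q.[N].
  by apply: lt_le_trans lc_gt0 (qM _ _); rewrite le_max lexx orbT.
rewrite -q0E ltNge; apply/negP => q0_le0.
have [|x] := @poly_ivt _ q 0 N N_ge0.
  by rewrite q0_le0 ltW.
by move=> /andP[x_ge0 _]; apply/negP/q_noroot.
Qed.

(** [W *m W^T] contributes the squared norm of [v *m W]; strictness comes from the
    diagonal part, at any nonzero coordinate of [v]. *)
Lemma fa_cov_posdef (R : realType) (p k : nat) (W : 'M[R]_(p, k))
    (psi : 'rV[R]_p) (v : 'rV[R]_p) :
  (forall i, 0 < psi ord0 i) -> v != 0 ->
  0 < (v *m fa_cov W psi *m v^T) ord0 ord0.
Proof.
move=> psi_gt0 v_neq0; rewrite /fa_cov mulmxDr mulmxDl mxE ltr_wpDl //.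
  have -> : v *m (W *m W^T) *m v^T = (v *m W) *m (v *m W)^T.
    by rewrite trmx_mul !mulmxA.
  by rewrite mxE sumr_ge0 // => j _; rewrite !mxE -expr2 sqr_ge0.
have term_ge0 i : 0 <= (v *m diag_mx psi) ord0 i * v^T i ord0.
  rewrite mul_mx_diag !mxE mulrAC -expr2.
  by rewrite mulr_ge0 ?sqr_ge0 // ltW.
have /rV0Pn[i vi_neq0] := v_neq0.
rewrite mxE (bigD1 i) //= ltr_wpDr ?sumr_ge0 // mul_mx_diag !mxE mulrAC -expr2.
by rewrite mulr_gt0 // exprn_even_gt0.
Qed.

Lemma ppca_cov_fa (R : realType) (p k : nat) (W : 'M[R]_(p, k)) (s2 : R) :
  ppca_cov W s2 = fa_cov W (const_mx s2).
Proof. by rewrite /ppca_cov /fa_cov diag_const_mx. Qed.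

Lemma likelihood_gt0 (R : realType) (p n : nat) (X : 'I_n -> 'cV[R]_p)
    (S : 'M[R]_p) :
  0 < \det S -> 0 < likelihood X S.
Proof.
move=> S_gt0; apply: prodr_gt0 => i _.
rewrite /gaussian_pdf divr_gt0 ?expR_gt0 // sqrtr_gt0 mulr_gt0 //.
by rewrite exprn_gt0 // mulr_gt0 // pi_gt0.
Qed.

Lemma p_fa_gt0 (R : realType) (p k n : nat) (X : 'I_n -> 'cV[R]_p)
    (W : 'M[R]_(p, k)) (psi : 'rV[R]_p) :
  (forall i, 0 < psi ord0 i) -> 0 < p_fa X W psi.
Proof.
move=> psi_gt0; apply/likelihood_gt0/posdef_det_gt0 => v.
exact: fa_cov_posdef.
Qed.

Lemma p_ppca_gt0 (R : realType) (p k n : nat) (X : 'I_n -> 'cV[R]_p)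
    (W : 'M[R]_(p, k)) (s2 : R) :
  0 < s2 -> 0 < p_ppca X W s2.
Proof.
move=> s2_gt0; rewrite /p_ppca ppca_cov_fa.
by apply: p_fa_gt0 => i; rewrite mxE.
Qed.

Lemma max_likelihood_attained (R : realType) (p n : nat) (X : 'I_n -> 'cV[R]_p)
    (M : set 'M[R]_p) (S : 'M[R]_p) :
  M S -> (forall S', M S' -> likelihood X S' <= likelihood X S) ->
  max_likelihood X M = likelihood X S.
Proof.
move=> MS S_max; apply/eqP; rewrite eq_le; apply/andP; split.
  by apply: ge_sup => [|_ [S' MS' <-]]; [exists (likelihood X S), S | exact: S_max].
apply: ub_le_sup; last by exists S.
by exists (likelihood X S) => _ [S' MS' <-]; exact: S_max.
Qed.

Lemma max_likelihood_ppca (R : realType) (p k n : nat) (X : 'I_n -> 'cV[R]_p)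
    (W : 'M[R]_(p, k)) (s2 : R) :
  ppca_mle X W s2 -> max_likelihood X (@ppca_model R p k) = p_ppca X W s2.
Proof.
move=> [s2_gt0 W_max]; apply: max_likelihood_attained; first by exists W, s2.
by move=> _ [W' [s2' [s2'_gt0 ->]]]; exact: W_max.
Qed.

Lemma max_likelihood_fa (R : realType) (p k n : nat) (X : 'I_n -> 'cV[R]_p)
    (W : 'M[R]_(p, k)) (psi : 'rV[R]_p) :
  fa_mle X W psi -> max_likelihood X (@fa_model R p k) = p_fa X W psi.
Proof.
move=> [psi_gt0 W_max]; apply: max_likelihood_attained; first by exists W, psi.
by move=> _ [W' [psi' [psi'_gt0 ->]]]; exact: W_max.
Qed.

(** With [t] the common term and [s] the sum of the smaller [L j], the quadratic
    solved at [i] is [x ^+ 2 + (s - t) * x - t * s = (x - t) * (x + s)], whose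
    nonnegative root is [t]. Minimal models are covered as well, so this
    evaluates both PPCA and factor analysis. *)
Lemma sbic_L_const_term (R : realType) (d : Order.disp_t) (T : finPOrderType d)
    (n : nat) (phat : T -> R) (lam : T -> T -> R) (mult : T -> T -> nat)
    (i : T) :
  let t := sbic_term n phat lam mult i in
  let L := sbic_L n phat lam mult in
  0 <= t i ->
  (forall j, (j < i)%O -> t j = t i) ->
  (forall j, (j < i)%O -> 0 <= L j) ->
  L i = t i.
Proof.
move=> t L ti_ge0 tE L_ge0; rewrite /L sbic_LE /sbic_step; case: ifP => // _.
rewrite -/t -/L; set s := \sum_(j | _) L j.
have -> : \sum_(j | (j < i)%O) t j * L j = t i * s.
  by rewrite mulr_sumr; apply: eq_bigr => j /tE ->.
have s_ge0 : 0 <= s by exact: sumr_ge0.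
have -> : (- t i + s) ^+ 2 + 4 * (t i * s) = (t i + s) ^+ 2 by ring.
by rewrite sqrtr_sqr ger0_norm ?addr_ge0 //; field.
Qed.

(** The exponent [0] is [m - 1] for the multiplicity [m = 1]; the power is then
    [1] even for a single observation, where [ln n%:R = 0]. *)
Lemma ln_bic_term (R : realType) (n : nat) (a l : R) :
  (0 < n)%N -> 0 < a ->
  ln (a * (ln n%:R ^+ 0 / n%:R `^ l)) = ln a - l * ln n%:R.
Proof.
move=> n_gt0 a_gt0; have nR_gt0 : 0 < n%:R :> R by rewrite ltr0n.
rewrite expr0 mul1r lnM ?posrE ?invr_gt0 ?powR_gt0 //.
by rewrite lnV ?posrE ?powR_gt0 // ln_powR.
Qed.

Lemma L_ppcaE (R : realType) (p k n : nat) (X : 'I_n -> 'cV[R]_p) :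
  0 <= max_likelihood X (@ppca_model R p k) ->
  L_ppca k X = max_likelihood X (@ppca_model R p k)
    * (ln n%:R ^+ 0 / n%:R `^ ppca_fa_lambda R p k ord0 ord0).
Proof.
move=> phat_ge0; apply: sbic_L_const_term => [|j|j]; last 2 first.
- by rewrite ltEord ltn0.
- by rewrite ltEord ltn0.
- by rewrite /sbic_term expr0 mul1r mulr_ge0 // invr_ge0 powR_ge0.
Qed.

Lemma L_faE (R : realType) (p k n : nat) (X : 'I_n -> 'cV[R]_p) :
  0 <= max_likelihood X (@ppca_model R p k) ->
  0 <= max_likelihood X (@fa_model R p k) ->
  L_fa k X = max_likelihood X (@fa_model R p k)
    * (ln n%:R ^+ 0 / n%:R `^ ppca_fa_lambda R p k ord_max ord_max).
Proof.
move=> ppca_ge0 fa_ge0; apply: sbic_L_const_term => [|//|j].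
  by rewrite /sbic_term expr0 mul1r mulr_ge0 // invr_ge0 powR_ge0.
rewrite ltEord ltnS leqn0 => /eqP j0.
have -> : j = ord0 by exact: val_inj.
by rewrite -[X in 0 <= X]/(L_ppca k X) L_ppcaE // expr0 mul1r mulr_ge0 //.
Qed.

Theorem corollary5p3 (R : realType) (p k n : nat) (hk : (k < p)%N) (hn : (0 < n)%N)
    (X : 'I_n -> 'cV[R]_p)
    (W0 : 'M[R]_(p, k)) (s2 : R) (W1 : 'M[R]_(p, k)) (psi : 'rV[R]_p)
    (h0 : ppca_mle X W0 s2) (h1 : fa_mle X W1 psi) :
  [/\ ln (L_ppca k X) = ln (p_ppca X W0 s2)
        - (p%:R * k%:R + k%:R * (p%:R - k%:R + 1) + 2) / 4 * ln n%:R,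
      ln (L_fa k X) = ln (p_fa X W1 psi)
        - (p%:R * k%:R + k%:R * (p%:R - k%:R + 1) + 2 * p%:R) / 4 * ln n%:R
    & ln (L_fa k X) < ln (L_ppca k X) <->
      ln (p_fa X W1 psi / p_ppca X W0 s2) < (p%:R - 1) / 2 * ln n%:R].
Proof.
have p0_gt0 := p_ppca_gt0 X W0 h0.1.
have p1_gt0 := p_fa_gt0 X W1 h1.1.
have phat0 := max_likelihood_ppca h0.
have phat1 := max_likelihood_fa h1.
have lnL0 : ln (L_ppca k X) = ln (p_ppca X W0 s2)
    - (p%:R * k%:R + k%:R * (p%:R - k%:R + 1) + 2) / 4 * ln n%:R.
  by rewrite L_ppcaE phat0 ?ltW // ln_bic_term.
have lnL1 : ln (L_fa k X) = ln (p_fa X W1 psi)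
    - (p%:R * k%:R + k%:R * (p%:R - k%:R + 1) + 2 * p%:R) / 4 * ln n%:R.
  by rewrite L_faE ?phat0 ?phat1 ?ltW // ln_bic_term.
split=> //; rewrite lnL0 lnL1 ln_div ?posrE //.
(* The gap between the two learning coefficients is (2 * p - 2) / 4. *)
by split; lra.
Qed.
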